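(* Let $(X,d)$ be a metric space (not assumed complete) with $|X|\geqslant 3$, let $x^*\in X$, and let the mapping $T\colon X\to X$ be continuous. Suppose that: (i) $T$ does not possess periodic points of prime period $2$; (ii) $T$ is a generalized Chatterjea type mapping on $(M,d)$, where $M$ is an everywhere dense subset of $X$; (iii) there exists a point $x_0\in X$ such that the sequence of iterates $x_n=Tx_{n-1}$, $n=1,2,\ldots$, has a subsequence $(x_{n_k})$ converging to $x^*$. Then $x^*$ is a fixed point of $T$, and the number of fixed points of $T$ is at most two.
   Context: For a metric space $(X,d)$, a mapping $T\colon X\to X$ and a subset $M\subseteq X$ with at least three points, ''$T$ is a generalized Chatterjea type mapping on $(M,d)$'' means that there exists $\gamma\in[0,\frac13)$ such that $$d(Tx,Ty)+d(Ty,Tz)+d(Tx,Tz)\leqslant \gamma\,(d(x,Ty)+d(x,Tz)+d(y,Tx)+d(y,Tz)+d(z,Tx)+d(z,Ty))$$ holds for all three pairwise distinct points $x,y,z\in M$ (it is not required that $T$ maps $M$ into $M$; the inequality is only required for triples from $M$). A point $x\in X$ is a periodic point of prime period $2$ of $T$ if $T(Tx)=x$ and $Tx\neq x$. *)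

(* Defs.v *)
From mathcomp Require Import all_boot all_order all_algebra.
From mathcomp Require Import all_classical all_reals all_analysis.

Set Implicit Arguments.
Unset Strict Implicit.
Unset Printing Implicit Defensive.

Import Order.TTheory GRing.Theory Num.Theory.

Local Open Scope classical_set_scope.
Local Open Scope card_scope.
Local Open Scope ring_scope.

Definition fixed_points (X : Type) (T : X -> X) : set X := [set x | T x = x].

Definition periodic_point2 (X : Type) (T : X -> X) (x : X) : Prop :=
  T (T x) = x /\ T x <> x.

(* [M] is a subset of the ambient space and need not be stable under [T]. *)
Definition generalized_chatterjea (R : realType) (X : metricType R)
    (M : set X) (T : X -> X) : Prop :=
  `I_3 #<= M /\
  exists gamma : R, [/\ 0 <= gamma, gamma < 3^-1 &
    forall x y z : X, M x -> M y -> M z -> x <> y -> y <> z -> x <> z ->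
      mdist (T x) (T y) + mdist (T y) (T z) + mdist (T x) (T z) <=
      gamma * (mdist x (T y) + mdist x (T z) + mdist y (T x)
               + mdist y (T z) + mdist z (T x) + mdist z (T y))].

(* Main.v *)
(** Continuity of [T] and density of [M] extend the Chatterjea inequality to all
    triples of pairwise distinct points of [X].  As [T] has no point of prime
    period 2, three consecutive iterates of [x0] are pairwise distinct unless the
    orbit becomes stationary, and the inequality applied to them shows that the
    perimeter of the triangle they span is at least halved at each step.  Hence
    [d (x_n, T x_n)] tends to [0], which by continuity forces [T xstar = xstar]
    without any completeness.  Three distinct fixed points would span a triangle
    of perimeter [p > 0] with [p <= 2 gamma p < p]. *)
Require Import Defs.
From mathcomp Require Import all_boot all_order all_algebra.
From mathcomp Require Import all_classical all_reals all_analysis.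
From mathcomp Require Import lra.

Set Implicit Arguments.
Unset Strict Implicit.

Import Order.TTheory GRing.Theory Num.Theory.
Import numFieldNormedType.Exports.

Local Open Scope classical_set_scope.
Local Open Scope card_scope.
Local Open Scope ring_scope.

Lemma cvg_mdist {R : realType} {X : metricType R} {I : Type}
    {F : set_system I} {FF : Filter F} {f g : I -> X} {x y : X} :
  f @ F --> x -> g @ F --> y ->
  (fun t => mdist (f t) (g t)) @ F --> (mdist x y : R).
Proof.
move=> fx gy; apply/cvgrPdist_le => e e0.
have e2 : 0 < e / 2 by rewrite divr_gt0.
near=> t.
have fxt : mdist x (f t) <= e / 2.
  by near: t; exact: metricType_numDomainType.cvgr_dist_le.
have gyt : mdist y (g t) <= e / 2.
  by near: t; exact: metricType_numDomainType.cvgr_dist_le.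
(* The inequalities [t1], [t2] bound one sign of the difference and [t3], [t4] the other, each by
   [mdist x (f t) + mdist y (g t)]. *)
have t1 := metric_triangle x (f t) y.
have t2 := metric_triangle (f t) (g t) y.
have t3 := metric_triangle (f t) x (g t).
have t4 := metric_triangle x y (g t).
rewrite (metric_sym (g t) y) in t2; rewrite (metric_sym (f t) x) in t3.
by rewrite ler_norml; apply/andP; split; lra.
Unshelve. all: by end_near. Qed.

Lemma dense_cvg_seq (R : realType) (X : metricType R) (M : set X) (x : X) :
  dense M -> exists u : nat -> X, (forall n, M (u n)) /\ u @ \oo --> x.
Proof.
move=> dM.
have approx (n : nat) : exists y, M y /\ mdist x y < n.+1%:R^-1.
  have n0 : 0 < n.+1%:R^-1 :> R by rewrite invr_gt0.
  (* Density is stated for nonempty open sets, so the ball is replaced by its interior, which still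
     contains [x]. *)
  have [||y [xy My]] := dM (ball x (n.+1%:R^-1))°.
  - by exists x; exact: nbhsx_ballx.
  - exact: open_interior.
  - by exists y; split => //; move/interior_subset: xy; rewrite ballEmdist.
have [u uP] := choice approx.
exists u; split=> [n|]; first by case: (uP n).
apply/metricType_numDomainType.cvgrPdist_lt => e e0; near=> n.
apply: (lt_trans (uP n).2).
by near: n; exact: near_infty_natSinv_lt (PosNum e0).
Unshelve. all: by end_near. Qed.

(** Approximate [x], [y], [z] by sequences in [M]. Both sides are continuous in the three points, so
    the inequality passes to the limit once the approximants are pairwise distinct. *)
Lemma chatterjea_dense (R : realType) (X : metricType R) (T : X -> X)
    (M : set X) (gamma : R) :
  continuous T -> dense M ->
  (forall x y z : X, M x -> M y -> M z -> x <> y -> y <> z -> x <> z ->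
    mdist (T x) (T y) + mdist (T y) (T z) + mdist (T x) (T z) <=
    gamma * (mdist x (T y) + mdist x (T z) + mdist y (T x)
             + mdist y (T z) + mdist z (T x) + mdist z (T y))) ->
  forall x y z : X, x <> y -> y <> z -> x <> z ->
    mdist (T x) (T y) + mdist (T y) (T z) + mdist (T x) (T z) <=
    gamma * (mdist x (T y) + mdist x (T z) + mdist y (T x)
             + mdist y (T z) + mdist z (T x) + mdist z (T y)).
Proof.
move=> cT dM MT x y z xy yz xz.
have [u [Mu ux]] := dense_cvg_seq x dM.
have [v [Mv vy]] := dense_cvg_seq y dM.
have [w [Mw wz]] := dense_cvg_seq z dM.
have Tcvg (a : X) (s : nat -> X) : s @ \oo --> a -> T \o s @ \oo --> T a.
  by move=> sa; exact: (cvg_comp _ _ sa (cT a)).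
(* The distances between the terms tend to [mdist a b > 0], hence are eventually positive. *)
have sep (a b : X) (s t : nat -> X) : a <> b -> s @ \oo --> a -> t @ \oo --> b ->
    \forall n \near \oo, s n <> t n.
  move=> /eqP ab sa tb; have ab0 : 0 < mdist a b by rewrite mdist_gt0.
  apply: filterS (cvgr_gt _ (cvg_mdist sa tb) _ ab0) => n.
  by rewrite mdist_gt0 => /eqP.
have Tu := Tcvg _ _ ux; have Tv := Tcvg _ _ vy; have Tw := Tcvg _ _ wz.
apply: (@ler_cvg_to _ \oo).
- exact: cvgD (cvgD (cvg_mdist Tu Tv) (cvg_mdist Tv Tw)) (cvg_mdist Tu Tw).
- apply: cvgMl_tmp; exact: cvgD (cvgD (cvgD (cvgD (cvgD
    (cvg_mdist ux Tv) (cvg_mdist ux Tw)) (cvg_mdist vy Tu))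
    (cvg_mdist vy Tw)) (cvg_mdist wz Tu)) (cvg_mdist wz Tv).
near=> n; apply: MT => //; near: n.
- exact: sep xy ux vy.
- exact: sep yz vy wz.
- exact: sep xz ux wz.
Unshelve. all: by end_near. Qed.

(** One or two points picked from a nonempty [S] exhaust it, so an image of [I_2] covers [S]. *)
Lemma card_le_I2 (A : Type) (S : set A) :
  (forall x y z, S x -> S y -> S z -> x <> y -> y <> z -> x <> z -> False) ->
  S #<= `I_2.
Proof.
move=> no3; have [->|/set0P[x Sx]] := eqVneq S set0; first exact: card_ge0.
have [Sx1|/existsNP[y /not_implyP[Sy yx]]] := pselect (forall y, S y -> y = x).
  apply: card_le_trans (card_image_le (fun=> x) `I_2).
  by apply: subset_card_le => y /Sx1 ->; exists 0%N.
apply: card_le_trans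
  (card_image_le (fun n => if n == 0%N then x else y) `I_2).
apply: subset_card_le => z Sz /=.
have [zx|zx] := pselect (z = x); first by exists 0%N.
have [zy|zy] := pselect (z = y); first by exists 1%N.
by case: (no3 x y z Sx Sy Sz); apply: nesym.
Qed.

Definition triangle_perimeter (R : realType) (X : metricType R) (T : X -> X)
    (x : X) : R :=
  mdist x (T x) + mdist (T x) (T (T x)) + mdist x (T (T x)).

Lemma triangle_perimeter_ge0 (R : realType) (X : metricType R) (T : X -> X)
    (x : X) : 0 <= triangle_perimeter T x.
Proof. by rewrite !addr_ge0 ?mdist_ge0. Qed.

Section chatterjea.
Variables (R : realType) (X : metricType R) (T : X -> X) (gamma : R).
Hypothesis gamma_lt : gamma < 3^-1.
Hypothesis chatterjea : forall x y z : X, x <> y -> y <> z -> x <> z ->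
  mdist (T x) (T y) + mdist (T y) (T z) + mdist (T x) (T z) <=
  gamma * (mdist x (T y) + mdist x (T z) + mdist y (T x)
           + mdist y (T z) + mdist z (T x) + mdist z (T y)).
Hypothesis no_period2 : ~ (exists x : X, periodic_point2 T x).

(** Trading [gamma] for a numerical constant makes the perimeter estimate linear in the
    distances. *)
Lemma chatterjea_le_third (x y z : X) : x <> y -> y <> z -> x <> z ->
  mdist (T x) (T y) + mdist (T y) (T z) + mdist (T x) (T z) <=
  3^-1 * (mdist x (T y) + mdist x (T z) + mdist y (T x)
          + mdist y (T z) + mdist z (T x) + mdist z (T y)).
Proof.
move=> xy yz xz; apply: le_trans (chatterjea xy yz xz) _.
by apply: ler_wpM2r; [rewrite !addr_ge0 ?mdist_ge0|exact: ltW].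
Qed.

Lemma chatterjea_card_fixed_points : fixed_points T #<= `I_2.
Proof.
apply: card_le_I2 => x y z Tx Ty Tz xy yz xz.
have := chatterjea xy yz xz.
rewrite Tx Ty Tz (metric_sym y x) (metric_sym z x) (metric_sym z y).
have xy0 : 0 < mdist x y by rewrite mdist_gt0; exact/eqP.
have yz0 := mdist_ge0 y z; have xz0 := mdist_ge0 x z.
set p := mdist x y + mdist y z + mdist x z.
have p0 : 0 < p by rewrite /p; lra.
(* Between fixed points, each side occurs twice among the six cross distances. *)
have -> : mdist x y + mdist x z + mdist x y + mdist y z + mdist x z + mdist y z
  = 2 * p by rewrite /p; lra.
by have := gamma_lt; nra.
Qed.

(* With [a_i, b_i] the distances from [x_i] to [x_(i+1), x_(i+2)] and [p_i] the
   perimeter, the triangle inequality gives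
   [3 p_1 <= p_0 + 2 b_1 <= p_0 + p_1]. *)
Lemma triangle_perimeter_half (x : X) :
  triangle_perimeter T (T x) <= triangle_perimeter T x / 2.
Proof.
(* If [T x] is already fixed, the next triangle collapses to a point and has perimeter 0. *)
have [TTx|TTx] := pselect (T (T x) = T x).
  have := triangle_perimeter_ge0 T x.
  by rewrite {2}/triangle_perimeter !TTx mdistxx; lra.
have Tx : T x <> x by move=> Tx; apply: TTx; rewrite !Tx.
have T2x : T (T x) <> x by move=> T2x; apply: no_period2; exists x.
have := chatterjea_le_third (nesym Tx) (nesym TTx) (nesym T2x).
have := metric_triangle x (T x) (T (T (T x))).
have := metric_triangle (T x) (T (T x)) (T (T (T x))).
rewrite /triangle_perimeter !mdistxx (metric_sym (T (T x)) (T x)).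
lra.
Qed.

Lemma triangle_perimeter_iter (x : X) (n : nat) :
  triangle_perimeter T (iter n T x) <= geometric (triangle_perimeter T x) 2^-1 n.
Proof.
elim: n => [|n IH]; first by rewrite /= expr0 mulr1.
apply: le_trans (triangle_perimeter_half _) _.
by rewrite /= exprSr mulrA ler_wpM2r ?invr_ge0.
Qed.

(** The distance is one side of the triangle of consecutive iterates, so it is squeezed between 0
    and the geometric bound on the perimeter. *)
Lemma cvg_mdist_iter (x : X) :
  (fun n => mdist (iter n T x) (T (iter n T x))) @ \oo --> (0 : R).
Proof.
have half : `|2^-1 : R| < 1 by rewrite ger0_norm ?invr_ge0//; lra.
apply: (squeeze_cvgr _ (cvg_cst _) (cvg_geometric (triangle_perimeter T x) half)).
near=> n; rewrite mdist_ge0 /= (le_trans _ (triangle_perimeter_iter x n))//.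
by rewrite /triangle_perimeter -addrA lerDl addr_ge0 ?mdist_ge0.
Unshelve. all: by end_near. Qed.

End chatterjea.

(** Strict growth in the naturals forces [n <= u n]. This carries limits along the whole orbit over
    to the subsequence. *)
Lemma increasing_seq_cvgn (u : nat -> nat) : increasing_seq u -> u @ \oo --> \oo.
Proof.
move=> /increasing_seqP u_incr.
have u_ge n : (n <= u n)%N.
  by elim: n => // n IH; apply: leq_ltn_trans IH _; exact: u_incr.
move=> P [N _ NP]; exists N => // n /= Nn; apply: NP => /=.
exact: leq_trans Nn (u_ge n).
Qed.

Theorem theorem4p2 (R : realType) (X : metricType R)
    (X3 : `I_3 #<= [set: X])
    (xstar : X) (T : X -> X) (T_cont : continuous T)
    (no_period2 : ~ (exists x : X, periodic_point2 T x))
    (M : set X) (M_dense : dense M)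
    (T_chatterjea : generalized_chatterjea M T)
    (x0 : X) (nk : nat -> nat) (nk_incr : increasing_seq nk)
    (nk_cvg : (fun k => iter (nk k) T x0) @ \oo --> xstar) :
  fixed_points T xstar /\ fixed_points T #<= `I_2.
Proof.
have [_ [gamma [_ gamma_lt MT]]] := T_chatterjea.
have XT := chatterjea_dense T_cont M_dense MT.
split; last exact: chatterjea_card_fixed_points gamma_lt XT.
have Tnk : (fun k => T (iter (nk k) T x0)) @ \oo --> T xstar.
  exact: (cvg_comp _ _ nk_cvg (T_cont xstar)).
have dist0 : (fun k => mdist (iter (nk k) T x0) (T (iter (nk k) T x0))) @ \oo
    --> (0 : R).
  exact: (cvg_comp _ _ (increasing_seq_cvgn nk_incr)
    (cvg_mdist_iter gamma_lt XT no_period2 x0)).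
(* Along the subsequence the distances tend both to [mdist xstar (T xstar)] and to 0, so the two
   limits agree. *)
apply/esym/mdist_positivity.
exact: cvg_unique (cvg_mdist nk_cvg Tnk) dist0.
Qed.
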